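(* Let $\mathbf w = w_1 w_2 w_3\ldots$ be an infinite word over the alphabet of positive integers, and for $n\ge 1$ let $p(n,\mathbf w)$ be the number of distinct factors of length $n$ of $\mathbf w$. If there exists an integer $k$ such that $$p(n,\mathbf w)\le n+k \quad\text{for all } n\ge 1,$$ then the real number $[0;w_1,w_2,\ldots]$ has a L\'evy constant.
   Context: For an infinite word $\mathbf w=w_1w_2\ldots$, $p(n,\mathbf w)=\operatorname{Card}\{w_{i+1}\ldots w_{i+n} : i\ge 1\}$ (the complexity function). For an irrational real number $\alpha=[a_0;a_1,a_2,\ldots]$ (regular continued fraction expansion), let $P_n(\alpha)/Q_n(\alpha)=[a_0;a_1,\ldots,a_n]$ in lowest terms, $n\ge1$. We say $\alpha$ has a L\'evy constant if the sequence $\big(\tfrac1n\log Q_n(\alpha)\big)_{n\ge1}$ converges to a finite limit, denoted $\mathcal L(\alpha)$. *)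

(* Defs.v *)
From HB Require Import structures.
From mathcomp Require Import all_boot all_order all_algebra.
From mathcomp Require Import all_classical all_reals all_analysis.

Set Implicit Arguments.
Unset Strict Implicit.
Unset Printing Implicit Defensive.

Import Order.TTheory GRing.Theory Num.Theory.
Import numFieldNormedType.Exports.
Local Open Scope classical_set_scope.
Local Open Scope ring_scope.

(* An infinite word w_1 w_2 w_3 ... is a function w : nat -> nat with
   w i standing for the letter w_{i+1}. *)

Definition word_factor (w : nat -> nat) (n i : nat) : n.-tuple nat :=
  [tuple w (i + j)%N | j < n].

(* p(n, w); +oo when w has infinitely many factors of length n. *)
Definition complexity (R : realType) (n : nat) (w : nat -> nat) : \bar R :=
  counting (range (word_factor w n)).

(* [a_0; a_1, ..., a_n] in the field F *)
Fixpoint cfrac (F : fieldType) (a : nat -> int) (n : nat) : F :=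
  if n is m.+1 then (a 0%N)%:~R + (cfrac F (fun i => a i.+1) m)^-1
  else (a 0%N)%:~R.

(* [a_0; a_1, a_2, ...]; the limit exists as soon as a_n >= 1 for n >= 1. *)
Definition inf_cfrac (R : realType) (a : nat -> int) : R :=
  lim (cfrac R a n @[n --> \oo]).

Definition cf_quotients_of_word (w : nat -> nat) (n : nat) : int :=
  if n is m.+1 then (w m)%:Z else 0.

(* Complete quotients: x_0 = x and x_{n+1} = 1 / (x_n - floor x_n). *)
Fixpoint complete_quotient (R : realType) (x : R) (n : nat) : R :=
  if n is m.+1 then
    let y := complete_quotient x m in (y - (Num.floor y)%:~R)^-1
  else x.

Definition partial_quotient (R : realType) (x : R) (n : nat) : int :=
  Num.floor (complete_quotient x n).

(* P_n(x) / Q_n(x); being of type rat, it is automatically in lowest terms. *)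
Definition convergent (R : realType) (x : R) (n : nat) : rat :=
  cfrac rat (partial_quotient x) n.

Definition convergent_den (R : realType) (x : R) (n : nat) : int :=
  denq (convergent x n).

(* The shift n.+1 makes the sequence start at index 1. *)
Definition has_Levy_constant (R : realType) (x : R) : Prop :=
  irrational x /\
  cvgn (fun n : nat => ln ((convergent_den x n.+1)%:~R : R) / n.+1%:R).

(* Main.v *)
Require Import Defs.
From mathcomp Require Import all_boot all_order all_algebra finmap.
From mathcomp Require Import all_classical all_reals all_analysis.
From mathcomp Require Import zify ring lra.

Set Implicit Arguments.
Unset Strict Implicit.
Unset Printing Implicit Defensive.

Import Order.TTheory GRing.Theory Num.Theory.
Import numFieldNormedType.Exports.
Local Open Scope classical_set_scope.
Local Open Scope ring_scope.

(** Write K(u) for the continuant of a finite word u, so that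
Q_n = K(w_1 ... w_n).  Since K(u) K(v) <= K(uv) <= 2 K(u) K(v), the function
ln K is additive on words up to a bounded error.  As p(n) <= n + k, infinitely
many n satisfy p(n+1) <= p(n) + 1, and then at most one factor r of length n has
several right extensions.  Unless w is eventually periodic, the gaps between
occurrences of r are at most p(n) <= 2n: avoiding r for longer forces some other
factor to be repeated, which starts a cycle.  Now let M and m be the largest and
the smallest asymptotic growth rates of ln K over all windows of w.  Occurrences
of r fill a fixed proportion of any long window, so ln K(r) / n can be neither
much smaller than M nor much larger than m; hence M = m. *)

(** * Syndetic values and periodicity *)

Definition syndetic_value {T : Type} (f : nat -> T) (L : nat) (v : T) : Prop :=
  forall i, exists2 j, (i <= j <= i + L)%N & f j = v.

Lemma syndetic_valueW (T : Type) (f : nat -> T) L L' v :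
  (L <= L')%N -> syndetic_value f L v -> syndetic_value f L' v.
Proof.
move=> LL' syn i; have [j /andP[ij jL] fj] := syn i; exists j => //.
by rewrite ij (leq_trans jL)// leq_add2l.
Qed.

Lemma syndetic_value_comp (T U : Type) (g : T -> U) (f : nat -> T) L v :
  syndetic_value f L v -> syndetic_value (g \o f) L (g v).
Proof. by move=> fv i; have [j ij <-] := fv i; exists j. Qed.

Definition periodic_from {T : Type} (N d : nat) (f : nat -> T) : Prop :=
  forall t, (N <= t)%N -> f (t + d)%N = f t.

Definition eventually_periodic {T : Type} (f : nat -> T) : Prop :=
  exists N d, (0 < d)%N /\ periodic_from N d f.

Section Sequences.
Local Open Scope nat_scope.

Lemma periodic_from_syndetic_value (T : Type) (f : nat -> T) N d :
  0 < d -> periodic_from N d f -> syndetic_value f (N + d) (f N).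
Proof.
move=> d0 per i.
have perM q : f (N + q * d) = f N.
  elim: q => [|q IHq]; first by rewrite addn0.
  by rewrite mulSnr addnA per ?leq_addr.
exists (N + (i %/ d).+1 * d) => //.
by have := divn_eq i d; have := ltn_pmod i d0; rewrite mulSnr; lia.
Qed.

Lemma finite_range_collision (T : choiceType) (f : nat -> T) i :
  finite_set (range f) ->
  exists s t, [/\ i <= s < t, t <= i + #|` fset_set (range f)| & f s = f t].
Proof.
move=> fin; apply: contrapT => nocoll; set p := #|` _| in nocoll.
have f_inj : {in `I_p.+1 &, injective (fun t => f (i + t))}.
  move=> s t; rewrite !inE /= => sp tp fst.
  have [st|ts|//] := ltngtP s t; case: nocoll.
  - by exists (i + s), (i + t); split=> //; lia.
  - by exists (i + t), (i + s); split=> //; lia.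
suff : p.+1 <= p by rewrite ltnn.
apply: leq_card_fset_set => //; rewrite -(card_le_eql (inj_card_eq f_inj)).
by apply: subset_card_le => _ [t _ <-]; exists (i + t).
Qed.

(* A state repeated without meeting r in between starts a cycle, since all the
   states of the cycle have a determined successor. *)
Lemma avoiding_cycle_periodic (T : Type) (f : nat -> T) (r : T) i d :
  (forall s t, f s = f t -> f s <> r -> f s.+1 = f t.+1) ->
  0 < d -> f (i + d) = f i -> (forall t, i <= t < i + d -> f t <> r) ->
  periodic_from i d f.
Proof.
move=> det d0 fid avoid.
have cycle t : f (i + t) <> r /\ f (i + t + d) = f (i + t).
  elim/ltn_ind: t => t IH; split.
    have [td|dt] := ltnP t d; first by apply: avoid; lia.
    have [ftd] := IH (t - d) ltac:(lia).
    by rewrite -addnA subnK// => ->.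
  case: t IH => [|t] IH; first by rewrite addn0.
  have [ftr ft] := IH t (leqnn _).
  by rewrite addnS addSn; apply: det => //; rewrite ft.
by move=> t it; have [_] := cycle (t - i); rewrite subnKC.
Qed.

Lemma syndetic_value_or_periodic (T : choiceType) (f : nat -> T) (r : T) :
  finite_set (range f) ->
  (forall s t, f s = f t -> f s <> r -> f s.+1 = f t.+1) ->
  syndetic_value f #|` fset_set (range f)| r \/ eventually_periodic f.
Proof.
move=> fin det; set p := #|` _|.
have [|nsyn] := pselect (syndetic_value f p r); first by left.
right; have [i avoid] : exists i, forall j, i <= j <= i + p -> f j <> r.
  apply: contrapT => noavoid; apply: nsyn => i; apply: contrapT => nocc.
  by apply: noavoid; exists i => j ij fj; apply: nocc; exists j.
have [s [t [/andP[is_ st] ti fst]]] := finite_range_collision i fin.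
exists s, (t - s); split; first lia.
apply: (avoiding_cycle_periodic det); first lia.
  by rewrite subnKC// ltnW.
by move=> u su; apply: avoid; lia.
Qed.

Lemma frequently_small_increment (p : nat -> nat) (a k : nat) :
  (forall n, 0 < n -> p n <= a * n + k) ->
  forall n0, exists2 n, n0 <= n & p n.+1 <= p n + a.
Proof.
move=> pk n0; apply: contrapT => fast.
have grow t : a.+1 * t <= p (n0 + t).
  elim: t => [|t IHt]; first by rewrite muln0.
  rewrite addnS mulnS leqNgt; apply/negP => lt_p; apply: fast.
  by exists (n0 + t); [exact: leq_addr | lia].
have := grow (a * n0 + k).+1; have := pk (n0 + (a * n0 + k).+1).
by rewrite addnS => /(_ isT); lia.
Qed.

End Sequences.

Section FsetCollisions.
Local Open Scope fset_scope.

Lemma imfset_fsetD1_collision (T U : choiceType) (f : T -> U) (S : {fset T})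
    x y :
  y \in S -> y != x -> f y = f x -> f @` (S `\ x) = f @` S.
Proof.
move=> yS yx fyx; apply/eqP; rewrite eqEfsubset; apply/andP; split.
  apply/fsubsetP => _ /imfsetP[z /= + ->]; rewrite !inE => /andP[_ zS].
  exact: in_imfset.
apply/fsubsetP => _ /imfsetP[z /= zS ->]; have [->|zx] := eqVneq z x.
  by rewrite -fyx in_imfset//= !inE yx.
by rewrite in_imfset//= !inE zx.
Qed.

Lemma card_imfset_collisions2 (T U : choiceType) (f : T -> U) (S : {fset T})
    x x' y y' :
  [/\ x \in S, x' \in S, y \in S & y' \in S] -> x' != x -> y' != y ->
  f x' = f x -> f y' = f y -> f x != f y -> (#|` f @` S| + 2 <= #|` S|)%N.
Proof.
move=> [xS x'S yS y'S] x'x y'y fx fy fxy.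
have yx : y != x by apply: contraNneq fxy => ->.
have y'x : y' != x by apply: contraNneq fxy => <-; rewrite fy.
rewrite -(imfset_fsetD1_collision x'S x'x fx).
rewrite -(imfset_fsetD1_collision _ y'y fy) ?inE ?y'x//.
rewrite (cardfsD1 x S) xS (cardfsD1 y (S `\ x)) !inE yx yS addn2 !add1n !ltnS.
exact: leq_imfset_card.
Qed.

End FsetCollisions.

(** * Factors of words of low complexity *)

Section WordFactors.
Local Open Scope nat_scope.
Implicit Types (w : nat -> nat) (n i j k : nat).

Definition factor_count w n : nat := #|` fset_set (range (word_factor w n))|.

Definition right_special w n (r : n.-tuple nat) : Prop :=
  exists i j, [/\ word_factor w n i = r, word_factor w n j = r &
                  w (i + n) <> w (j + n)].

Lemma word_factorP w n i j :
  word_factor w n i = word_factor w n j <->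
  forall t, t < n -> w (i + t) = w (j + t).
Proof.
split=> [wij t tn|wij].
  have := congr1 (fun s => tnth s (Ordinal tn)) wij.
  by rewrite !tnth_mktuple.
by apply: eq_from_tnth => t; rewrite !tnth_mktuple wij.
Qed.

Lemma word_factorS w n i j :
  word_factor w n.+1 i = word_factor w n.+1 j <->
  word_factor w n i = word_factor w n j /\ w (i + n) = w (j + n).
Proof.
rewrite !word_factorP; split=> [wij|[wij wn] t].
  by split=> [t tn|]; apply: wij => //; exact: ltnW.
by rewrite ltnS leq_eqVlt => /predU1P[->|/wij].
Qed.

Lemma word_factor_shift w n i j :
  word_factor w n.+1 i = word_factor w n.+1 j ->
  word_factor w n i.+1 = word_factor w n j.+1.
Proof.
move/word_factorP => wij; apply/word_factorP => t tn.
by rewrite !addSnnS; exact: wij.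
Qed.

Lemma periodic_from_word_factor w n N d :
  periodic_from N d w -> periodic_from N d (word_factor w n).
Proof.
move=> per i Ni; apply/word_factorP => t _.
by rewrite addnAC per// (leq_trans Ni)// leq_addr.
Qed.

Lemma word_factor_periodic_from w n N d :
  0 < n -> periodic_from N d (word_factor w n) -> periodic_from N d w.
Proof.
by move=> n0 per t /per/word_factorP/(_ 0 n0); rewrite !addn0.
Qed.

Lemma not_right_special w n i j :
  ~ right_special w (word_factor w n i) ->
  word_factor w n i = word_factor w n j -> w (i + n) = w (j + n).
Proof.
by move=> nrs wij; apply: contrapT => wn; apply: nrs; exists i, j.
Qed.

Lemma right_special_unique w n (r s : n.-tuple nat) :
  finite_set (range (word_factor w n.+1)) ->
  factor_count w n.+1 <= factor_count w n + 1 ->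
  right_special w r -> right_special w s -> r = s.
Proof.
move=> fin count [i [i' [ri ri' wii']]] [j [j' [sj sj' wjj']]].
pose init (u : n.+1.-tuple nat) :=
  [tuple tnth u (widen_ord (leqnSn n) t) | t < n].
have init_factor l : init (word_factor w n.+1 l) = word_factor w n l.
  by apply: eq_from_tnth => t; rewrite !tnth_mktuple.
have rangeE : fset_set (range (word_factor w n)) =
    (init @` fset_set (range (word_factor w n.+1)))%fset.
  rewrite -fset_set_image// image_comp; congr fset_set.
  by apply: eq_imagel => l _; rewrite /= init_factor.
have factor_in l :
    word_factor w n.+1 l \in fset_set (range (word_factor w n.+1)).
  by rewrite in_fset_set// inE; exists l.
apply: contrapT => rs; move: count; rewrite leqNgt => /negP; apply.
rewrite -addnS /factor_count rangeE.
apply: (@card_imfset_collisions2 _ _ init _ (word_factor w n.+1 i)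
  (word_factor w n.+1 i') (word_factor w n.+1 j) (word_factor w n.+1 j')).
all: rewrite ?init_factor ?ri ?ri' ?sj ?sj'//.
- by apply/eqP => /word_factorS[_ /esym].
- by apply/eqP => /word_factorS[_ /esym].
- exact/eqP.
Qed.

Lemma word_factor_succ_determined w n r :
  (forall s : n.-tuple nat, right_special w s -> s = r) ->
  forall i j, word_factor w n i = word_factor w n j -> word_factor w n i <> r ->
    word_factor w n i.+1 = word_factor w n j.+1.
Proof.
move=> uniq_r i j wij ir.
apply: word_factor_shift; apply/word_factorS; split=> //.
by apply: not_right_special => // /uniq_r.
Qed.

Lemma right_special_at_most_one w n :
  finite_set (range (word_factor w n.+1)) ->
  factor_count w n.+1 <= factor_count w n + 1 ->
  exists r : n.-tuple nat, forall s : n.-tuple nat,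
    right_special w s -> s = r.
Proof.
move=> fin count.
have [[r rs]|nrs] := pselect (exists r : n.-tuple nat, right_special w r).
  by exists r => s ss; exact: right_special_unique fin count ss rs.
by exists (word_factor w n 0) => s ss; case: nrs; exists s.
Qed.

Lemma frequently_syndetic_factor w k :
  (forall n, 0 < n -> finite_set (range (word_factor w n))) ->
  (forall n, 0 < n -> factor_count w n <= n + k) ->
  forall n0, exists2 n, n0 <= n &
    exists r, syndetic_value (word_factor w n) (2 * n) r.
Proof.
move=> fin count n0.
have [[N [d [d0 per]]]|aper] := pselect (eventually_periodic w).
  exists (n0 + (N + d)); first exact: leq_addr.
  have syn := periodic_from_syndetic_value d0
    (periodic_from_word_factor (n0 + (N + d)) per).
  by eexists; apply: syndetic_valueW syn; lia.
have count1 n : 0 < n -> factor_count w n <= 1 * n + k.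
  by rewrite mul1n; exact: count.
have [n nn slow] := frequently_small_increment count1 (n0 + k).+1.
have n_gt0 : 0 < n by lia.
have [r uniq_r] := right_special_at_most_one (fin n.+1 isT) slow.
exists n; first lia.
exists r; have [syn|[N [d [d0 per]]]] :=
  syndetic_value_or_periodic (fin n n_gt0) (word_factor_succ_determined uniq_r).
  by apply: syndetic_valueW syn; apply: leq_trans (count n n_gt0) _; lia.
by case: aper; exists N, d; split=> //; exact: word_factor_periodic_from per.
Qed.

Lemma finite_range_bounded (f : nat -> nat) :
  finite_set (range f) -> exists B, forall i, f i <= B.
Proof.
move=> fin; exists (\max_(m <- fset_set (range f)) m) => i.
by apply: leq_bigmax_seq => //; rewrite in_fset_set// inE; exists i.
Qed.

Lemma bounded_letters w :
  finite_set (range (word_factor w 1)) -> exists B, forall i, w i <= B.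
Proof.
move=> fin; apply: finite_range_bounded.
have -> : range w = (@tnth 1 nat)^~ ord0 @` range (word_factor w 1).
  by rewrite image_comp; apply: eq_imagel => i _; rewrite /= tnth_mktuple addn0.
exact: finite_image.
Qed.

Lemma complexity_le_EFin (R : realType) w n (x : R) :
  (complexity R n w <= x%:E)%E ->
  finite_set (range (word_factor w n)) /\ ((factor_count w n)%:R <= x)%R.
Proof. by rewrite /complexity /counting; case: asboolP. Qed.

End WordFactors.

(** * Growth of almost additive functions of windows *)

Section LinearRates.
Context {R : realType}.
Implicit Types (a b e l K : R) (u : nat -> R).

Lemma ler_slope_frequently a b K :
  (forall n0, exists2 n, (n0 <= n)%N & a * n%:R <= b * n%:R + K) -> a <= b.
Proof.
move=> abK; rewrite leNgt; apply/negP => ba.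
have [n0 _ n0P] := nbhs_infty_gtr (K / (a - b)).
have [n /n0P/= + abn] := abK n0.
by rewrite ltr_pdivrMr ?subr_gt0//; lra.
Qed.

Lemma cvg_average u l :
  (forall e, 0 < e -> exists K, forall n, `|u n - l * n%:R| <= e * n%:R + K) ->
  u n.+1 / n.+1%:R @[n --> \oo] --> l.
Proof.
move=> ul; apply/cvgrPdist_le => e e0.
have e20 : 0 < e / 2 by lra.
have [K uK] := ul _ e20.
have [n0 _ n0P] := nbhs_infty_gtr (K / (e / 2)).
exists n0 => // n /= n0n.
have := n0P n.+1 (leqW n0n); rewrite /= ltr_pdivrMr// => Kn.
rewrite distrC -(@ler_pM2r _ n.+1%:R)// -[X in _ * X]gtr0_norm// -normrM.
by rewrite mulrBl divfK ?gt_eqF//; have := uK n.+1; lra.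
Qed.

End LinearRates.

(* F i n stands for the value of F on the window w_i ... w_(i+n-1) of a word. *)
Definition subadditive {R : realType} (F : nat -> nat -> R) (c : R) : Prop :=
  forall i m n, F i (m + n)%N <= F i m + F (i + m)%N n + c.

Definition almost_additive {R : realType} (F : nat -> nat -> R) (c : R) :
    Prop :=
  forall i m n, `|F i (m + n)%N - F i m - F (i + m)%N n| <= c.

Definition linearly_bounded {R : realType} (F : nat -> nat -> R) (B : R) :
    Prop :=
  forall i n, `|F i n| <= B * n%:R.

Section UpperGrowth.
Context {R : realType}.
Implicit Types (F : nat -> nat -> R) (c B : R).

Definition upper_slopes F : set R :=
  [set x | exists K, forall i n, F i n <= x * n%:R + K].

Definition upper_growth F : R := inf (upper_slopes F).

Lemma upper_slopes_has_inf F B :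
  linearly_bounded F B -> has_inf (upper_slopes F).
Proof.
move=> FB; split.
  exists B, 0 => i n; rewrite addr0; exact: le_trans (ler_norm _) (FB i n).
exists (- B) => x [K FK].
apply: (@ler_slope_frequently _ _ _ K) => n; exists n => //.
by have := FB 0%N n; have := FK 0%N n; rewrite ler_norml; lra.
Qed.

Lemma upper_growth_adherent F B e : linearly_bounded F B -> 0 < e ->
  exists K, forall i n, F i n <= (upper_growth F + e) * n%:R + K.
Proof.
move=> /upper_slopes_has_inf infF e0.
have [x [K FK] /ltW xe] := inf_adherent e0 infF.
by exists K => i n; apply: le_trans (FK i n) _; rewrite lerD2r ler_wpM2r.
Qed.

Lemma subadditive_blocks F c z b q i s : subadditive F c ->
  (forall j, F j b <= z) ->
  exists j, F i (q * b + s)%N <= (z + c) * q%:R + F j s.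
Proof.
move=> subF Fz; elim: q i => [|q IHq] i; first by exists i; rewrite mulr0 add0r.
have [j Fj] := IHq (i + b)%N; exists j.
rewrite mulSn -addnA; apply: le_trans (subF _ _ _) _.
by have := Fz i; rewrite -natr1; lra.
Qed.

Lemma upper_growth_le_block F c B z b : subadditive F c ->
  linearly_bounded F B -> (0 < b)%N -> (forall i, F i b <= z) ->
  upper_growth F * b%:R <= z + c.
Proof.
move=> subF FB b0 Fz; have bR : 0 < (b%:R : R) by rewrite ltr0n.
have B0 : 0 <= B by have := FB 0%N 1%N; rewrite mulr1; exact: le_trans.
rewrite -ler_pdivlMr//; set y := (z + c) / b%:R.
apply: ge_inf; first exact: (upper_slopes_has_inf FB).2.
exists ((`|y| + B) * b%:R) => i n; rewrite (divn_eq n b).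
have sb : ((n %% b)%:R : R) <= b%:R by rewrite ler_nat ltnW// ltn_mod.
move: (n %/ b)%N (n %% b)%N sb => q s sb.
have [j Fq] := subadditive_blocks q i s subF Fz.
have Fs : F j s <= B * b%:R.
  by rewrite (le_trans (ler_norm _))// (le_trans (FB _ _))// ler_wpM2l.
have ys : - (y * s%:R) <= `|y| * b%:R.
  by rewrite (le_trans (ler_norm _))// normrN normrM normr_nat ler_wpM2l.
have yq : (z + c) * q%:R = y * (q * b)%:R by rewrite natrM /y; field; lra.
by rewrite natrD; lra.
Qed.

(* A window of length (C + 1) n splits as a prefix, an occurrence of the value
   r and a suffix; the prefix and the suffix grow at most at the upper rate. *)
Lemma upper_growth_syndetic_le F c B C e : subadditive F c ->
  linearly_bounded F B -> 0 < e ->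
  exists D, forall n r, (0 < n)%N -> syndetic_value (F^~ n) (C * n) r ->
    upper_growth F * n%:R <= r + e * n%:R + D.
Proof.
move=> subF FB e0; set M := upper_growth F.
pose d := e / C.+1%:R.
have d0 : 0 < d by rewrite divr_gt0.
have [K FK] := upper_growth_adherent FB d0; rewrite -/M in FK.
exists (2 * K + 3 * c) => n r n0 synr.
pose z := (M + d) * (C * n)%:R + r + (2 * K + 2 * c).
have blockz i : F i (C.+1 * n)%N <= z.
  have [j /andP[ij jC] Fj] := synr i.
  have -> : (C.+1 * n = (j - i) + (n + (i + C * n - j)))%N by lia.
  have := subF i (j - i)%N (n + (i + C * n - j))%N; rewrite subnKC//.
  have := subF j n (i + C * n - j)%N.
  have := FK i (j - i)%N; have := FK (j + n)%N (i + C * n - j)%N.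
  have : (j - i)%:R + (i + C * n - j)%:R = (C * n)%:R :> R.
    by rewrite -natrD; congr _%:R; lia.
  by rewrite /z => <-; rewrite Fj; lra.
have b0 : (0 < C.+1 * n)%N by rewrite muln_gt0.
have := upper_growth_le_block subF FB b0 blockz; rewrite -/M /z.
have dC : d * (C * n)%:R <= e * n%:R.
  rewrite natrM mulrA ler_wpM2r// /d mulrAC ler_pdivrMr//.
  by rewrite ler_wpM2l ?ler_nat ?(ltW e0).
by rewrite mulSn natrD; lra.
Qed.

End UpperGrowth.

Section AlmostAdditive.
Context {R : realType}.
Variables (F : nat -> nat -> R) (c B : R).
Hypotheses (addF : almost_additive F c) (boundF : linearly_bounded F B).
Let oppF i n := - F i n.

Lemma almost_additive_subadditive : subadditive F c.
Proof. by move=> i m n; have := addF i m n; rewrite ler_norml; lra. Qed.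

Lemma almost_additiveN_subadditive : subadditive oppF c.
Proof. by move=> i m n; have := addF i m n; rewrite ler_norml /oppF; lra. Qed.

Lemma linearly_boundedN : linearly_bounded oppF B.
Proof. by move=> i n; rewrite normrN. Qed.

Variable C : nat.
Hypothesis frequently_syndetic : forall n0, exists2 n, (n0 <= n)%N &
  exists r, syndetic_value (F^~ n) (C * n) r.

Lemma upper_growthDN_le0 : upper_growth F + upper_growth oppF <= 0.
Proof.
apply/ler_addgt0Pr => e e0; rewrite add0r.
have e20 : 0 < e / 2 by lra.
have [D DP] := upper_growth_syndetic_le C
  almost_additive_subadditive boundF e20.
have [D' DP'] := upper_growth_syndetic_le C
  almost_additiveN_subadditive linearly_boundedN e20.
apply: (@ler_slope_frequently _ _ _ (D + D')) => n0.
have [n nn [r synr]] := frequently_syndetic n0.+1; exists n; first exact: ltnW.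
have n_gt0 : (0 < n)%N by exact: leq_trans nn.
have := DP n r n_gt0 synr.
have := DP' n (- r) n_gt0 (syndetic_value_comp -%R synr).
lra.
Qed.

Lemma cvg_almost_additive :
  F 0%N n.+1 / n.+1%:R @[n --> \oo] --> upper_growth F.
Proof.
apply: cvg_average => e e0.
have [K FK] := upper_growth_adherent boundF e0.
have [K' FK'] := upper_growth_adherent linearly_boundedN e0.
exists (`|K| + `|K'|) => n; rewrite ler_norml.
have := FK 0%N n; have := FK' 0%N n; rewrite /oppF.
have := ler_norm K; have := ler_norm K'.
have : (upper_growth F + upper_growth oppF) * n%:R <= 0.
  by rewrite mulr_le0_ge0// upper_growthDN_le0.
have := normr_ge0 K; have := normr_ge0 K'.
by lra.
Qed.

End AlmostAdditive.

(** * Regular continued fractions *)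

Definition regular_quotients (a : nat -> int) : Prop := forall n, 0 < a n.+1.

Lemma regular_quotients_behead (a : nat -> int) :
  regular_quotients a -> regular_quotients (fun i => a i.+1).
Proof. by move=> areg i; exact: areg. Qed.

Section RegularContinuedFractions.
Context (R : realType).
Implicit Types a : nat -> int.

Lemma cfrac_bounds a n : regular_quotients a ->
  (a 0%N)%:~R <= cfrac R a n <= (a 0%N)%:~R + 1.
Proof.
elim: n a => [|n IHn] a areg /=; first by rewrite lexx ler_wpDr.
have /andP[a1le _] := IHn _ (regular_quotients_behead areg).
have le1 : 1 <= cfrac R (fun i => a i.+1) n.
  by apply: le_trans a1le; rewrite ler1z -gtz0_ge1.
have gt0 := lt_le_trans ltr01 le1.
by rewrite lerDl lerD2l invr_ge0 (ltW gt0) invf_le1.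
Qed.

Lemma cfrac_behead_ge1 a n :
  regular_quotients a -> 1 <= cfrac R (fun i => a i.+1) n.
Proof.
move=> areg; have /andP[+ _] := cfrac_bounds n (regular_quotients_behead areg).
by apply: le_trans; rewrite ler1z -gtz0_ge1.
Qed.

(* For x, y, q >= 1 the Moebius map x |-> 1 / (q + 1 / x) = x / (q x + 1) has
   determinant 1 and denominator at least 2. *)
Lemma dist_inv_addV (q x y : R) : 1 <= q -> 1 <= x -> 1 <= y ->
  `|(q + x^-1)^-1 - (q + y^-1)^-1| <= 2^-1 * `|x - y|.
Proof.
move=> q1 x1 y1; have qx : 2 <= q * x + 1 by nra.
have qy : 2 <= q * y + 1 by nra.
have den2 : 2 <= (q * x + 1) * (q * y + 1) by nra.
have -> : (q + x^-1)^-1 - (q + y^-1)^-1 = (x - y) / ((q * x + 1) * (q * y + 1)).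
  by field; nra.
rewrite normrM mulrC ler_wpM2r// gtr0_norm ?invr_gt0 ?lef_pV2 ?posrE//; lra.
Qed.

Lemma cfrac_dist a k n m : regular_quotients a ->
  `|cfrac R a (k.*2 + n)%N - cfrac R a (k.*2 + m)%N| <= 2^-1 ^+ k.
Proof.
elim: k a => [|k IHk] a areg.
  have := cfrac_bounds n areg; have := cfrac_bounds m areg.
  by rewrite !add0n expr0 ler_norml; lra.
have tail1 j : 1 <= cfrac R (fun i => a i.+2) j.
  exact: cfrac_behead_ge1 (regular_quotients_behead areg).
rewrite doubleS !addSn /= opprD addrACA subrr add0r.
apply: le_trans (dist_inv_addV _ (tail1 _) (tail1 _)) _.
  by rewrite ler1z -gtz0_ge1.
by rewrite exprS ler_wpM2l ?invr_ge0// IHk.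
Qed.

Lemma is_cvg_cfrac a : regular_quotients a -> cvgn (cfrac R a).
Proof.
move=> areg; apply: R_complete; apply: cauchy_exP => e e0.
have [k _ /(_ k (leqnn k))/= ek] := nbhs_infty_gtr e^-1.
exists (cfrac R a k.*2); exists k.*2 => // n /= kn.
rewrite /ball /= -{1}(addn0 k.*2) -(subnKC kn).
apply: le_lt_trans (cfrac_dist _ _ _ areg) _.
rewrite exprVn -[ltRHS]invrK ltf_pV2 ?posrE ?exprn_gt0 ?invr_gt0//.
by apply: lt_trans ek _; rewrite -natrX ltr_nat ltn_expl.
Qed.

Lemma inf_cfrac_behead_ge1 a :
  regular_quotients a -> 1 <= inf_cfrac R (fun i => a i.+1).
Proof.
move=> areg; apply: limr_ge.
  exact: is_cvg_cfrac (regular_quotients_behead areg).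
by apply: nearW => n; exact: cfrac_behead_ge1.
Qed.

Lemma inf_cfracS a : regular_quotients a ->
  inf_cfrac R a = (a 0%N)%:~R + (inf_cfrac R (fun i => a i.+1))^-1.
Proof.
move=> areg; have tail1 := inf_cfrac_behead_ge1 areg.
apply: cvg_lim => //; rewrite -cvg_shiftS /=.
apply: cvgD; first exact: cvg_cst.
apply: cvgV; first by rewrite gt_eqF// (lt_le_trans ltr01).
exact: is_cvg_cfrac (regular_quotients_behead areg).
Qed.

Lemma inf_cfrac_behead_gt1 a :
  regular_quotients a -> 1 < inf_cfrac R (fun i => a i.+1).
Proof.
move=> areg; have areg1 := regular_quotients_behead areg.
have a1 : 1 <= (a 1%N)%:~R :> R by rewrite ler1z -gtz0_ge1.
rewrite inf_cfracS// (le_lt_trans a1)// ltrDl invr_gt0.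
exact: lt_le_trans ltr01 (inf_cfrac_behead_ge1 areg1).
Qed.

Lemma floor_inf_cfrac a : regular_quotients a ->
  Num.floor (inf_cfrac R a) = a 0%N.
Proof.
move=> areg; have tail1 := inf_cfrac_behead_gt1 areg.
have tail0 := lt_trans ltr01 tail1.
apply: floor_def; rewrite inf_cfracS// intrD lerDl ltrD2l.
by rewrite invr_ge0 ltW//= invf_lt1.
Qed.

Lemma complete_quotientSr (x : R) n :
  complete_quotient x n.+1 = complete_quotient (x - (Num.floor x)%:~R)^-1 n.
Proof.
by elim: n => [//|n IHn]; rewrite [LHS]/= -/(complete_quotient x n.+1) IHn.
Qed.

Lemma partial_quotient_inf_cfrac a :
  regular_quotients a -> partial_quotient (inf_cfrac R a) = a.
Proof.
move=> areg; apply/funext => n; rewrite /partial_quotient.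
elim: n a areg => [|n IHn] a areg; first exact: floor_inf_cfrac.
rewrite complete_quotientSr floor_inf_cfrac// inf_cfracS// addrC addKr invrK.
exact: IHn (regular_quotients_behead areg).
Qed.

(* Passing from [a_0; a_1, ...] = p / q to [a_1; a_2, ...] = q / (p - a_0 q)
   decreases the denominator, as in the Euclidean algorithm. *)
Lemma inf_cfrac_neq_frac a (p : int) (q : nat) : regular_quotients a ->
  (0 < q)%N -> inf_cfrac R a * q%:R <> p%:~R.
Proof.
elim/ltn_ind: q p a => q IHq p a areg q0 xq.
have tail1 := inf_cfrac_behead_gt1 areg; have tail0 := lt_trans ltr01 tail1.
have qR : 0 < q%:R :> R by rewrite ltr0n.
set y := inf_cfrac R _ in tail1 tail0; pose r := p - a 0%N * q%:Z.
have yr : y * r%:~R = q%:R.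
  rewrite /r intrB intrM -xq inf_cfracS// -/y -pmulrn; field.
  by rewrite gt_eqF.
have r0 : 0 < r by rewrite -(ltr0z R) -(pmulr_rgt0 _ tail0) yr.
have rE : r%:~R = `|r|%N%:R :> R by rewrite natr_absz gtr0_norm.
apply: (IHq `|r|%N _ q%:Z (fun i => a i.+1)); last by rewrite -rE.
- by rewrite -(ltr_nat R) -rE -yr ltr_pMl// ltr0z.
- exact: regular_quotients_behead.
- by rewrite absz_gt0 gt_eqF.
Qed.

Lemma inf_cfrac_irrational a :
  regular_quotients a -> irrational (inf_cfrac R a).
Proof.
move=> areg [x _ xE]; apply: (@inf_cfrac_neq_frac _ (numq x) `|denq x|%N areg).
  by rewrite absz_gt0 denq_neq0.
by rewrite -xE natr_absz gtr0_norm// divfK// intr_eq0 denq_neq0.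
Qed.

End RegularContinuedFractions.

(** * Continuants *)

Section Continuants.
Local Open Scope nat_scope.

Fixpoint continuant (w : nat -> nat) (i n : nat) : nat :=
  match n with
  | 0 => 1
  | 1 => w i
  | (m.+1 as p).+1 => w i * continuant w i.+1 p + continuant w i.+2 m
  end.

Lemma continuantSS w i n :
  continuant w i n.+2 = w i * continuant w i.+1 n.+1 + continuant w i.+2 n.
Proof. by []. Qed.

Lemma continuant_word_factor w n i j :
  word_factor w n i = word_factor w n j -> continuant w i n = continuant w j n.
Proof.
move/word_factorP; elim/ltn_ind: n i j => -[//|[|n]] IH i j wij.
  by have := wij 0 isT; rewrite !addn0.
have := wij 0 isT; rewrite !addn0 !continuantSS => ->.
by congr (_ * _ + _); apply: IH => // t tn; rewrite !addSnnS wij.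
Qed.

Variable w : nat -> nat.
Hypothesis w_pos : forall i, 0 < w i.

Lemma continuant_gt0 i n : 0 < continuant w i n.
Proof.
elim/ltn_ind: n i => -[//|[|n]] IH i; first exact: w_pos.
by rewrite continuantSS addn_gt0 muln_gt0 w_pos IH.
Qed.

Lemma continuant_behead_le i n : continuant w i.+1 n <= continuant w i n.+1.
Proof.
case: n => [|n]; first exact: w_pos.
by rewrite continuantSS (leq_trans _ (leq_addr _ _))// leq_pmull.
Qed.

Lemma continuant_cat_ge i m n :
  continuant w i m * continuant w (i + m) n <= continuant w i (m + n).
Proof.
elim/ltn_ind: m i => -[|[|m]] IH i; first by rewrite mul1n addn0.
  by case: n {IH} => [|n]; rewrite ?muln1// addn1 add1n continuantSS leq_addr.
have := IH m.+1 (leqnn _) i.+1; have := IH m (leqnSn _) i.+2.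
rewrite (addSnnS i.+1) !(addSnnS i).
by rewrite !addSn !continuantSS; nia.
Qed.

Lemma continuant_cat_le i m n :
  continuant w i (m + n) <= 2 * (continuant w i m * continuant w (i + m) n).
Proof.
elim/ltn_ind: m i => -[|[|m]] IH i; first by rewrite mul1n addn0 leq_pmull.
  case: n {IH} => [|n]; first by rewrite /= muln1 leq_pmull.
  rewrite addn1 add1n continuantSS -[continuant w i 1]/(w i).
  by have := continuant_behead_le i.+1 n; have := w_pos i; nia.
have := IH m.+1 (leqnn _) i.+1; have := IH m (leqnSn _) i.+2.
rewrite (addSnnS i.+1) !(addSnnS i).
by rewrite !addSn !continuantSS; nia.
Qed.

Lemma continuant_le_exp B i n :
  (forall j, w j <= B) -> continuant w i n <= B.+1 ^ n.
Proof.
move=> wB; elim/ltn_ind: n i => -[//|[|n]] IH i.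
  by rewrite expn1; exact: leqW (wB i).
rewrite continuantSS !expnS.
have := IH n.+1 (leqnn _) i.+1; have := IH n (leqnSn _) i.+2.
by have := wB i; rewrite expnS; nia.
Qed.

Lemma coprime_continuant i n :
  coprime (continuant w i n.+1) (continuant w i.+1 n).
Proof.
elim: n i => [|n IHn] i; first by rewrite coprimen1.
by rewrite continuantSS coprime_sym /coprime gcdnMDl; exact: IHn.
Qed.

End Continuants.

Section ContinuantsAndConvergents.
Variable w : nat -> nat.
Hypothesis w_pos : forall i, (0 < w i)%N.

Lemma cfrac_continuant (F : numFieldType) i n :
  cfrac F (fun j => (w (i + j)%N)%:Z) n =
  (continuant w i n.+1)%:R / (continuant w i.+1 n)%:R.
Proof.
elim: n i => [|n IHn] i; first by rewrite /= addn0 divr1.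
rewrite [LHS]/=; under [fun j => (w (i + j.+1)%N)%:Z]funext do rewrite -addSnnS.
rewrite IHn continuantSS addn0 invf_div natrD natrM mulrDl mulfK//.
by rewrite pnatr_eq0 -lt0n continuant_gt0.
Qed.

Lemma denq_cfrac_word n :
  denq (cfrac rat (cf_quotients_of_word w) n.+1) = (continuant w 0 n.+1)%:Z.
Proof.
have -> : cfrac rat (cf_quotients_of_word w) n.+1 =
    (cfrac rat (fun j => (w (0 + j)%N)%:Z) n)^-1 by rewrite /= mulr0z add0r.
rewrite cfrac_continuant invf_div !pmulrn coprimeq_den; last first.
  by rewrite coprime_sym; exact: coprime_continuant.
by rewrite eqz_nat gtn_eqF// continuant_gt0.
Qed.

Lemma regular_quotients_word : regular_quotients (cf_quotients_of_word w).
Proof. exact: w_pos. Qed.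

Lemma convergent_den_word (R : realType) n :
  convergent_den (inf_cfrac R (cf_quotients_of_word w)) n.+1 =
  (continuant w 0 n.+1)%:Z.
Proof.
rewrite /convergent_den /convergent -denq_cfrac_word.
by rewrite (partial_quotient_inf_cfrac R regular_quotients_word).
Qed.

Variable R : realType.

Definition ln_continuant i n : R := ln (continuant w i n)%:R.

Lemma ln_continuant_almost_additive : almost_additive ln_continuant (ln 2).
Proof.
move=> i m n; have K0 j l : 0 < ((continuant w j l)%:R : R).
  by rewrite ltr0n continuant_gt0.
have KK0 : 0 < (continuant w i m)%:R * (continuant w (i + m) n)%:R :> R.
  exact: mulr_gt0.
rewrite /ln_continuant -addrA -opprD -lnM ?posrE//.
rewrite ger0_norm ?subr_ge0; last first.
  by rewrite ler_ln ?posrE// -natrM ler_nat continuant_cat_ge.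
rewrite lerBlDr -lnM ?posrE// ler_ln ?posrE ?mulr_gt0//.
by rewrite -!natrM ler_nat continuant_cat_le.
Qed.

Lemma ln_continuant_linearly_bounded (B : nat) : (forall i, (w i <= B)%N) ->
  linearly_bounded ln_continuant (ln B.+1%:R).
Proof.
move=> wB i n; have K0 := continuant_gt0 w_pos i n.
rewrite /ln_continuant ger0_norm ?ln_ge0 ?ler1n//.
rewrite mulr_natr -lnXn// ler_ln ?posrE ?exprn_gt0 ?ltr0n//.
by rewrite -natrX ler_nat continuant_le_exp.
Qed.

Lemma syndetic_ln_continuant n L r :
  syndetic_value (word_factor w n) L r ->
  exists v, syndetic_value (ln_continuant^~ n) L v.
Proof.
move=> syn; have [j _ jr] := syn 0%N; exists (ln_continuant j n) => i.
have [l il lr] := syn i; exists l => //.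
by congr (ln _%:R); apply: continuant_word_factor; rewrite lr jr.
Qed.

End ContinuantsAndConvergents.

Theorem theorem1p1 (R : realType) (w : nat -> nat)
    (w_pos : forall i : nat, (0 < w i)%N)
    (w_complexity : exists k : int, forall n : nat, (1 <= n)%N ->
       (complexity R n w <= ((n%:Z + k)%:~R : R)%:E)%E) :
  has_Levy_constant (inf_cfrac R (cf_quotients_of_word w)).
Proof.
have [k wk] := w_complexity.
have fin n : (0 < n)%N -> finite_set (range (word_factor w n)).
  by case/wk/complexity_le_EFin.
have count n : (0 < n)%N -> (factor_count w n <= n + `|k|)%N.
  by case/wk/complexity_le_EFin => _; rewrite pmulrn ler_int; lia.
have [B wB] := bounded_letters (fin 1%N isT).
split; first exact: inf_cfrac_irrational (regular_quotients_word w_pos).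
under eq_fun do rewrite convergent_den_word// -pmulrn -/(ln_continuant w R 0 _).
apply/cvg_ex; exists (upper_growth (ln_continuant w R)).
apply: (cvg_almost_additive (ln_continuant_almost_additive w_pos R)
  (ln_continuant_linearly_bounded w_pos R wB) (C := 2)) => n0.
have [n n0n [r syn]] := frequently_syndetic_factor fin count n0.
by exists n => //; exact: syndetic_ln_continuant syn.
Qed.
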